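(* Let $M=\{\mathcal A,\mathcal H,ds\}$ be a spectral geometry on a compact metric space $(X,|\cdot|)$. Assume that a sequence $\{\rho_i\}$ of marked spectra of bounded deformations of $M$ converges in the uniform topology to the marked spectrum $\rho_0$ of a bounded deformation of $M$. Then for the associated Connes metrics on $X$ we have $|d_{\rho_i}d_{\rho_0}|_L\to0$ as $i\to\infty$.
   Context: $|xy|$ is the distance in $X$; $\Delta\subset X^2$ is the diagonal; $|b|=|yy'|$ for $b=(y,y')$. Spectral geometry (in the concrete form to which every axiomatically defined one is isomorphic): a triple $M=M(B,m)=\{\mathcal A,\mathcal H,ds\}$ where $B=\mathrm{supp}\,M\subset X^2\setminus\Delta$ is symmetric under $(y,y')\mapsto(y',y)$ and $\{b\in B:|b|\ge t\}$ is finite for each $t>0$; $m:B\to\mathbb N$ is a symmetric function; $\mathcal H$ consists of square-summable sections $\xi$ on $B$, $\xi(y,y')\in\mathbb C^{m(y,y')}$; $\mathcal A$ is the algebra of Lipschitz functions on $X$ acting by $(\pi(a)\xi)(y,y')=a(y)\xi(y,y')$; $(ds\,\xi)(y,y')=|yy'|\xi(y',y)$. Bounded deformation: a positive symmetric function $\rho:B\to\mathbb R$ (the marked spectrum) such that $\rho(y,y')/|yy'|$ is bounded and separated from zero on $B$; $(ds_\rho\xi)(y,y')=\rho(y,y')\xi(y',y)$, $\mathcal D_\rho=ds_\rho^{-1}$, $\|[\mathcal D_\rho,\pi(a)]\|=\sup_{(y,y')\in B}|a(y)-a(y')|/\rho(y,y')$. The Connes metric is $d_\rho(x,x')=\sup\{|a(x)-a(x')|:a\in\mathcal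 A,\ \|[\mathcal D_\rho,\pi(a)]\|\le1\}\in[0,\infty]$. Uniform topology: basic neighborhoods of $\rho_0$ are $\{\rho:|1/\rho_0(y,y')-1/\rho(y,y')|<\varepsilon\ \forall(y,y')\in B\}$, $\varepsilon>0$. Lipschitz distance: $|dd'|_L=\sup_{x\ne y}|\log(d'(x,y)/d(x,y))|$; pairs at which both $d$ and $d'$ are infinite contribute $0$. *)

(* Defs.v *)
From mathcomp Require Import all_boot all_order all_algebra.
From mathcomp Require Import all_classical all_reals all_analysis.
From mathcomp Require Import complex.

Set Implicit Arguments.
Unset Strict Implicit.
Unset Printing Implicit Defensive.

Import Order.TTheory GRing.Theory Num.Theory.
Import ComplexField.Normc.

Local Open Scope classical_set_scope.
Local Open Scope ring_scope.
Local Open Scope complex_scope.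

Section SpectralGeometry.
Context {R : realType} {X : metricType R}.

Definition len (b : X * X) : R := mdist b.1 b.2.

(* The pair (B, m).  Values of [mult] off [supp] are irrelevant.
   [mult_gt0]: the support B is where the fibre C^m is nonzero. *)
Record spectral_geometry := SpectralGeometry {
  supp : set (X * X);
  mult : X * X -> nat;
  supp_offdiag : forall b, supp b -> b.1 != b.2;
  supp_sym : forall b, supp b -> supp (swap_pair b);
  supp_finite : forall t : R, 0 < t -> finite_set (supp `&` [set b | t <= len b]);
  mult_gt0 : forall b, supp b -> (0 < mult b)%N;
  mult_sym : forall b, supp b -> mult (swap_pair b) = mult b }.

(* The algebra A; the Lipschitz predicate of the library does not apply to
   maps from a metric space into R[i]. *)
Definition lipschitz_fun (a : X -> R[i]) :=
  exists L : R, forall x y, normc (a x - a y) <= L * mdist x y.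

(* [xi b k] is the [k]-th coordinate of the vector xi(b) in C^(mult b), for b
   in [supp] and k < mult b; all other values are forced to be 0 by
   [is_section].  This avoids a cast between the fibres at b and swap_pair b. *)
Definition section := X * X -> nat -> R[i].

Definition pi_rep (a : X -> R[i]) (xi : section) : section :=
  fun b k => a b.1 * xi b k.

Definition ds_rho (rho : X * X -> R) (xi : section) : section :=
  fun b k => (rho b)%:C * xi (swap_pair b) k.

Definition dirac_op (rho : X * X -> R) (xi : section) : section :=
  fun b k => ((rho b)^-1)%:C * xi (swap_pair b) k.

Definition commutator (rho : X * X -> R) (a : X -> R[i]) (xi : section)
    : section :=
  fun b k => dirac_op rho (pi_rep a xi) b k - pi_rep a (dirac_op rho xi) b k.

Variable M : spectral_geometry.

Definition is_section (xi : section) :=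
  forall b k, ~ (supp M b /\ (k < mult M b)%N) -> xi b k = 0.

Definition hnorm (xi : section) : \bar R :=
  sqrte (\esum_(b in supp M) (\sum_(k < mult M b) normc (xi b k) ^+ 2)%:E)%E.

Definition hilbert : set section :=
  [set xi | is_section xi /\ (hnorm xi < +oo)%E].

Definition ds : section -> section := ds_rho len.

(* [dirac_op rho] is the inverse of [ds_rho rho] (see [ds_rhoK], [dirac_opK]), an
   unbounded operator whose domain is the range of [ds_rho rho] on H. *)
Definition dirac_dom (rho : X * X -> R) : set section :=
  ds_rho rho @` hilbert.

(* Operator norm of [D_rho, pi(a)], in [0, +oo]. *)
Definition commutator_norm (rho : X * X -> R) (a : X -> R[i]) : \bar R :=
  ereal_sup [set hnorm (commutator rho a xi) | xi in
    [set xi | [/\ dirac_dom rho xi, dirac_dom rho (pi_rep a xi) &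
                  (hnorm xi <= 1)%E]]].

(* [rho] is the marked spectrum of a bounded deformation of [M]; only its
   values on [supp M] matter. *)
Definition bounded_deformation (rho : X * X -> R) :=
  [/\ forall b, supp M b -> 0 < rho b,
      forall b, supp M b -> rho (swap_pair b) = rho b &
      exists c C : R, 0 < c /\
        forall b, supp M b -> c <= rho b / len b <= C].

Definition connes_dist (rho : X * X -> R) (x x' : X) : \bar R :=
  ereal_sup [set (normc (a x - a x'))%:E | a in
    [set a | lipschitz_fun a /\ (commutator_norm rho a <= 1)%E]].

Definition unif_nbhd (rho0 : X * X -> R) (e : R) : set (X * X -> R) :=
  [set rho | forall b, supp M b -> `|(rho0 b)^-1 - (rho b)^-1| < e].

Definition unif_cvg (rho : nat -> X * X -> R) (rho0 : X * X -> R) :=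
  forall e : R, 0 < e -> \forall i \near \oo, unif_nbhd rho0 e (rho i).

(* Extended-real conventions: 0^-1 = +oo, +oo^-1 = 0, lne 0 = -oo and
   lne +oo = +oo, so the value is +oo if exactly one of [u], [v] is infinite. *)
Definition log_ratio (u v : \bar R) : \bar R :=
  (if (u == +oo) && (v == +oo) then 0 else `|lne (v / u)|)%E.

(* The supremum is taken in [0, +oo], i.e. it is 0 if X has at most one
   point. *)
Definition lipschitz_dist (d d' : X -> X -> \bar R) : \bar R :=
  maxe 0%E (ereal_sup [set log_ratio (d p.1 p.2) (d' p.1 p.2) | p in
                        [set p : X * X | p.1 != p.2]]).

Lemma ds_rhoK rho xi : bounded_deformation rho -> is_section xi ->
  dirac_op rho (ds_rho rho xi) = xi.
Proof.
move=> [rho_gt0 rho_sym _] xiS; apply/funext => b; apply/funext => k.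
rewrite /dirac_op /ds_rho; have -> : swap_pair (swap_pair b) = b by case: b.
have [Bb|nBb] := pselect (supp M b); last first.
  by rewrite xiS ?mulr0// => -[].
by rewrite rho_sym// mulrA -rmorphM /= mulVf ?mul1r// gt_eqF// rho_gt0.
Qed.

Lemma dirac_opK rho xi : bounded_deformation rho -> is_section xi ->
  ds_rho rho (dirac_op rho xi) = xi.
Proof.
move=> [rho_gt0 rho_sym _] xiS; apply/funext => b; apply/funext => k.
rewrite /dirac_op /ds_rho; have -> : swap_pair (swap_pair b) = b by case: b.
have [Bb|nBb] := pselect (supp M b); last first.
  by rewrite xiS ?mulr0// => -[].
by rewrite rho_sym// mulrA -rmorphM /= mulfV ?mul1r// gt_eqF// rho_gt0.
Qed.

End SpectralGeometry.

Arguments spectral_geometry {R} X.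

(* Main.v *)
(* Testing [D_rho, pi(a)] on sections supported at one point of B shows that its
   norm is at most 1 iff |a(y) - a(y')| <= rho(y,y') on B; hence rho <= s rho'
   implies d_rho <= s d_rho'.  The lengths |b|, b in B, are bounded, so
   rho0 <= K for some K, and |1/rho0 - 1/rho| < eps gives
   |1 - rho0/rho| < eps K.  Thus rho_i and rho0 are eventually comparable up to
   a factor s arbitrarily close to 1.  The distances are nonzero, since small
   multiples of z |-> |xz| are admissible, so |d_rho_i d_rho0|_L <= log s. *)

Require Import Defs.
From mathcomp Require Import all_boot all_order all_algebra.
From mathcomp Require Import all_classical all_reals all_analysis.
From mathcomp Require Import complex.
From mathcomp Require Import ring lra.

Local Open Scope classical_set_scope.
Local Open Scope ring_scope.

Import Order.TTheory GRing.Theory Num.Theory.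
Import ComplexField.Normc.

Set Implicit Arguments.
Unset Strict Implicit.
Unset Printing Implicit Defensive.

Section Normc.
Context {R : rcfType}.
Implicit Types (x y : R[i]) (r : R).

Lemma normc_ge0 x : 0 <= normc x.
Proof. by case: x => a b /=; exact: sqrtr_ge0. Qed.

Lemma normc_real r : normc (r%:C)%C = `|r|.
Proof. by rewrite /= expr0n /= addr0 sqrtr_sqr. Qed.

Lemma normcB x y : normc (x - y) = normc (y - x).
Proof.
by rewrite -(opprB y x); case: (y - x) => a b /=; rewrite !sqrrN.
Qed.

End Normc.

(** * The norm of the commutator, tested on one-point sections *)

Section CommutatorNorm.
Context {R : realType} {X : metricType R}.
Variable M : spectral_geometry X.
Implicit Types (b : X * X) (rho : X * X -> R) (a : X -> R[i]) (c : R[i]).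

(** One coordinate is enough for testing, because the commutator acts on each fibre as a swap times
    a scalar. Coordinate 0 exists over every point of the support, where [mult] is positive. *)
Definition point_section b c : @section R X :=
  fun b' k => if (b' == b) && (k == 0%N) then c else 0.

Lemma is_section_point b c : supp M b -> is_section M (point_section b c).
Proof.
move=> Bb b' k nB; rewrite /point_section.
by case: ifPn => // /andP[/eqP b'b /eqP k0]; case: nB; rewrite b'b k0 mult_gt0.
Qed.

Lemma hnorm_point b c : supp M b -> hnorm M (point_section b c) = (normc c)%:E.
Proof.
move=> Bb; rewrite /hnorm.
have -> : (\esum_(b' in supp M)
    (\sum_(k < mult M b') normc (point_section b c b' k) ^+ 2)%:E)%E =
    (\esum_(b' in supp M) (if b' \in [set b] then (normc c ^+ 2)%:E else 0))%E.
  apply: eq_esum => b' _; rewrite /point_section.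
  have [->|b'b] := eqVneq b' b.
    rewrite mem_set //; congr EFin.
    have := mult_gt0 Bb; case: (mult M b) => // n _.
    rewrite big_ord_recl eqxx big1 ?addr0// => i _.
    by rewrite normc0 expr0n.
  rewrite memNset; last exact/eqP.
  by congr EFin; rewrite big1 // => i _; rewrite normc0 expr0n.
rewrite -esum_mkcondr.
have -> : supp M `&` [set b] = [set b].
  by apply/seteqP; split => [b' []//|b' ->].
rewrite esum_set1 ?lee_fin ?sqr_ge0 //=.
by rewrite sqrtr_sqr ger0_norm // normc_ge0.
Qed.

Lemma swap_pair_eq b b' : (swap_pair b == b') = (b == swap_pair b').
Proof. by apply/eqP/eqP => [<-|->]; rewrite swap_pairK. Qed.

Lemma dirac_dom_point rho b c : supp M b -> 0 < rho b ->
  dirac_dom M rho (point_section b c).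
Proof.
(* [ds_rho] swaps base points, so the preimage sits over [swap_pair b]; the factor [(rho b)^-1]
   cancels the weight. *)
move=> Bb rb; exists (point_section (swap_pair b) ((rho b)^-1%:C * c)%C).
  split; first exact/is_section_point/supp_sym.
  by rewrite hnorm_point ?ltry //; exact: supp_sym.
apply/funext => b'; apply/funext => k.
rewrite /ds_rho /point_section swap_pair_eq swap_pairK.
case: ifPn => [/andP[/eqP -> _]|_]; last by rewrite mulr0.
by rewrite mulrA -rmorphM /= mulfV ?gt_eqF // mul1r.
Qed.

Lemma pi_rep_point a b c :
  pi_rep a (point_section b c) = point_section b (a b.1 * c).
Proof.
apply/funext => b'; apply/funext => k; rewrite /pi_rep /point_section.
by case: ifPn => [/andP[/eqP -> _]//|_]; rewrite mulr0.
Qed.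

Lemma commutatorE rho a (xi : section) b k :
  commutator rho a xi b k =
  (((rho b)^-1)%:C)%C * (a b.2 - a b.1) * xi (swap_pair b) k.
Proof. by rewrite /commutator /dirac_op /pi_rep /=; ring. Qed.

Lemma commutator_point rho a b c :
  commutator rho a (point_section (swap_pair b) c) =
  point_section b ((((rho b)^-1)%:C)%C * (a b.2 - a b.1) * c).
Proof.
apply/funext => b'; apply/funext => k.
rewrite commutatorE /point_section swap_pair_eq swap_pairK.
by case: ifPn => [/andP[/eqP -> _]//|_]; rewrite mulr0.
Qed.

(** The swap permutes the support and preserves multiplicities. This absorbs the swap built into
    [dirac_op]. *)
Lemma hnorm_swap (xi : section) :
  hnorm M (fun b => xi (swap_pair b)) = hnorm M xi.
Proof.
rewrite /hnorm [in RHS](reindex_esum (supp M) (supp M) swap_pair); last first.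
  split.
  - by move=> b; exact: supp_sym.
  - by move=> b b' _ _; exact: (can_inj swap_pairK).
  - by move=> b Bb; exists (swap_pair b); rewrite ?swap_pairK //; exact: supp_sym.
by congr (sqrte _); apply: eq_esum => b Bb; rewrite mult_sym.
Qed.

Lemma commutator_norm_le1 rho a : (forall b, supp M b -> 0 < rho b) ->
  (commutator_norm M rho a <= 1)%E <->
  (forall b, supp M b -> normc (a b.1 - a b.2) <= rho b).
Proof.
move=> rho_gt0; split=> [norm_le1 b Bb|a_le].
  have Bsb := supp_sym Bb.
  (* A unit vector over [swap_pair b] is sent over [b], multiplied by the weight
     [(a b.2 - a b.1) / rho b]. Its image under [pi_rep a] is again a one-point section, hence in
     the domain. *)
  have : (hnorm M (commutator rho a (point_section (swap_pair b) 1%R)) <= 1)%E.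
    apply: le_trans norm_le1; apply: ereal_sup_ubound.
    exists (point_section (swap_pair b) 1) => //; split.
    - by apply: dirac_dom_point => //; exact: rho_gt0.
    - by rewrite pi_rep_point; apply: dirac_dom_point => //; exact: rho_gt0.
    - by rewrite hnorm_point // normc1.
  rewrite commutator_point hnorm_point // lee_fin mulr1 normcM normc_real.
  have rb := rho_gt0 _ Bb.
  by rewrite gtr0_norm ?invr_gt0 // mulrC ler_pdivrMr // mul1r normcB.
apply: ge_ereal_sup => _ [xi [_ _ xi_le1] <-]; apply: le_trans xi_le1.
(* Against the swapped section the comparison is termwise: all weights have modulus at most 1. *)
rewrite -[leRHS]hnorm_swap /hnorm lee_sqrt; last first.
  by apply: esum_ge0 => b _; rewrite lee_fin sumr_ge0 // => k _; rewrite sqr_ge0.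
apply: le_esum => b Bb; rewrite lee_fin; apply: ler_sum => k _.
rewrite lerXn2r ?nnegrE ?normc_ge0 // commutatorE !normcM normc_real.
have rb := rho_gt0 _ Bb.
rewrite ler_piMl ?normc_ge0 // gtr0_norm ?invr_gt0 // mulrC ler_pdivrMr //.
by rewrite mul1r normcB a_le.
Qed.

End CommutatorNorm.

(** * Comparison of Connes distances *)

Section ConnesDistance.
Context {R : realType} {X : metricType R}.
Variable M : spectral_geometry X.
Implicit Types (rho : X * X -> R) (x y : X).

Lemma lipschitz_fun_scale (r : R) (a : X -> R[i]) :
  lipschitz_fun a -> lipschitz_fun (fun x => (r%:C)%C * a x).
Proof.
move=> [L aL]; exists (`|r| * L) => x y.
by rewrite -mulrBr normcM normc_real -mulrA ler_wpM2l.
Qed.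

(** If [a] is admissible for [rho], then [a / s] is admissible for [rho']. *)
Lemma connes_dist_le_scale rho rho' (s : R) x y : 0 < s ->
  (forall b, supp M b -> 0 < rho b) -> (forall b, supp M b -> 0 < rho' b) ->
  (forall b, supp M b -> rho b <= s * rho' b) ->
  (connes_dist M rho x y <= s%:E * connes_dist M rho' x y)%E.
Proof.
move=> s0 r0 r'0 rr'; apply: ge_ereal_sup => _ [a [aL /commutator_norm_le1 a1] <-].
pose a' := fun z => ((s^-1)%:C)%C * a z.
have a'E u v : normc (a' u - a' v) = s^-1 * normc (a u - a v).
  by rewrite -mulrBr normcM normc_real gtr0_norm ?invr_gt0.
rewrite (_ : normc _ = s * normc (a' x - a' y)); last first.
  by rewrite a'E mulrA mulfV ?mul1r ?gt_eqF.
rewrite EFinM lee_wpmul2l ?lee_fin ?(ltW s0) //; apply: ereal_sup_ubound.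
exists a' => //; split; first exact: lipschitz_fun_scale.
apply/commutator_norm_le1 => // b Bb.
by rewrite a'E mulrC ler_pdivrMr // mulrC (le_trans (a1 r0 _ Bb)) ?rr'.
Qed.

Lemma connes_dist_gt0 rho x y : bounded_deformation M rho -> x != y ->
  (0 < connes_dist M rho x y)%E.
Proof.
move=> [r0 _ [c [C [c0 rc]]]] xy.
(* With [c] the lower bound of [rho b / len b], this function varies by at most [c * len b <= rho b]
   along [b], so it is admissible; it separates [x] and [y] by [c * mdist x y]. *)
pose a z := ((c * mdist x z)%:C)%C.
have aE u v : normc (a u - a v) = c * `|mdist x u - mdist x v|.
  by rewrite -rmorphB normc_real -mulrBr normrM gtr0_norm.
have aL u v : normc (a u - a v) <= c * mdist u v.
  rewrite aE ler_wpM2l ?(ltW c0) // ler_distl.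
  have h1 := metric_triangle x u v.
  have h2 := metric_triangle x v u.
  by rewrite (metric_sym v u) in h2; apply/andP; split; lra.
apply: (@lt_le_trans _ _ (c * mdist x y)%:E).
  by rewrite lte_fin mulr_gt0 // mdist_gt0.
apply: ereal_sup_ubound; exists a.
  split; first by exists c.
  apply/commutator_norm_le1 => // b Bb; apply: le_trans (aL _ _) _.
  have /andP[+ _] := rc _ Bb; rewrite ler_pdivlMr //.
  by rewrite /len mdist_gt0; exact: supp_offdiag Bb.
by rewrite aE mdistxx sub0r normrN ger0_norm // mdist_ge0.
Qed.

Lemma len_bounded : exists2 D : R, 0 < D & forall b, supp M b -> len b <= D.
Proof.
have /finite_seqP[s sE] := supp_finite M ltr01.
(* The list [s] enumerates the pairs of length at least 1. The sum dominates each of these lengths,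
   and the summand 1 dominates the others. *)
exists (1 + \sum_(b <- s) len b).
  by rewrite ltr_pwDl // sumr_ge0 // => b _; exact: mdist_ge0.
move=> b Bb; have [b1|b1] := leP 1 (len b); last first.
  by rewrite (le_trans (ltW b1)) // lerDl sumr_ge0 // => ? _; exact: mdist_ge0.
have bs : b \in s by have : [set` s] b by rewrite -sE.
rewrite (big_rem b) //= addrCA lerDl addr_ge0 // sumr_ge0 // => ? _.
exact: mdist_ge0.
Qed.

Lemma bounded_deformation_ub rho : bounded_deformation M rho ->
  exists2 K : R, 0 < K & forall b, supp M b -> rho b <= K.
Proof.
move=> [r0 _ [c [C [c0 rc]]]]; have [D D0 lD] := len_bounded.
(* Over an empty support [C] may be negative; the absolute value and the summand 1 keep the bound
   positive. *)
exists (`|C| * D + 1); first by rewrite ltr_wpDl // mulr_ge0 // ltW.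
move=> b Bb; have /andP[_] := rc _ Bb; rewrite ler_pdivrMr; last first.
  by rewrite /len mdist_gt0; exact: supp_offdiag Bb.
move=> /le_trans -> //; apply: ler_wpDr => //.
apply: le_trans (ler_wpM2r (mdist_ge0 _ _) (ler_norm C)) _.
by rewrite ler_wpM2l ?lD.
Qed.

(** The two inequalities force [u] and [v] to be both finite or both infinite; in the latter case
    [log_ratio] is 0 by convention. Positivity keeps [lne] away from 0. *)
Lemma log_ratio_le (s : R) (u v : \bar R) : 1 <= s -> (0 < u)%E -> (0 < v)%E ->
  (u <= s%:E * v)%E -> (v <= s%:E * u)%E -> (log_ratio u v <= (ln s)%:E)%E.
Proof.
move=> s1; have s0 := lt_le_trans ltr01 s1; rewrite /log_ratio.
case: u v => [u||] [v||] //.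
  rewrite !lte_fin -!EFinM !lee_fin => u0 v0 uv vu /=.
  rewrite inver gt_eqF // -EFinM lne_EFin ?divr_gt0 // lee_fin.
  rewrite ler_norml -lnV ?posrE // !ler_ln ?posrE ?invr_gt0 ?divr_gt0 //.
  by rewrite ler_pdivlMr // ler_pdivrMr // vu andbT mulrC ler_pdivrMr // mulrC.
by rewrite eqxx lee_fin ln_ge0.
Qed.

(** Multiplying the difference of inverses by [rho0 b <= K] turns the radius into [1 - s^-1], so
    [rho0 b / rho b] lies between [s^-1] and [2 - s^-1]. *)
Lemma unif_nbhd_comparable rho rho0 (K s : R) : 1 < s -> 0 < K ->
  (forall b, supp M b -> 0 < rho b) ->
  (forall b, supp M b -> 0 < rho0 b <= K) ->
  unif_nbhd M rho0 ((1 - s^-1) / K) rho ->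
  forall b, supp M b -> rho b <= s * rho0 b /\ rho0 b <= s * rho b.
Proof.
move=> s1 K0 r0 r00 rn b Bb; have s0 := lt_trans ltr01 s1.
have := rn _ Bb; have /andP[q0 qK] := r00 _ Bb; have p0 := r0 _ Bb.
move: (rho b) (rho0 b) p0 q0 qK => p q p0 q0 qK pq.
have sV1 : 0 < 1 - s^-1 by rewrite subr_gt0 invf_lt1.
have : `|1 - q / p| < 1 - s^-1.
  have -> : 1 - q / p = q * (q^-1 - p^-1) by rewrite mulrBr mulfV ?gt_eqF.
  rewrite normrM gtr0_norm // mulrC -ltr_pdivlMr //; apply: lt_le_trans pq _.
  by rewrite ler_wpM2l ?(ltW sV1) // lef_pV2 ?posrE.
rewrite ltr_distlC opprB addrCA subrr addr0 => /andP[sq qs].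
split.
  move: sq; rewrite ltr_pdivlMr // mulrC ltr_pdivrMr // mulrC => /ltW //.
rewrite -ler_pdivrMr //; apply: (le_trans (ltW qs)).
(* The upper bound [2 - s^-1] is at most [s], since [s + s^-1 - 2] is this quotient. *)
suff : 0 <= (s - 1) ^+ 2 / s.
  have -> : (s - 1) ^+ 2 / s = s - (1 + (1 - s^-1)) by field; rewrite gt_eqF.
  by rewrite subr_ge0.
by rewrite divr_ge0 ?sqr_ge0 // ltW.
Qed.

End ConnesDistance.

Theorem proposition3p5 (R : realType) (X : metricType R)
    (M : spectral_geometry X) (rho : nat -> X * X -> R) (rho0 : X * X -> R) :
  compact [set: X] ->
  (forall i, bounded_deformation M (rho i)) ->
  bounded_deformation M rho0 ->
  unif_cvg M rho rho0 ->
  lipschitz_dist (connes_dist M (rho i)) (connes_dist M rho0)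
    @[i --> \oo] --> 0%E.
Proof.
move=> _ brho brho0 rho_cvg.
have [K K0 rho0K] := bounded_deformation_ub brho0.
have rho_gt0 i b : supp M b -> 0 < rho i b by case: (brho i) => + _ _; exact.
have rho0_gt0 b : supp M b -> 0 < rho0 b by case: brho0 => + _ _; exact.
set f := fun i => _.
have f_ge0 i : (0 <= f i)%E by rewrite /f /lipschitz_dist le_max lexx.
have f_le e : 0 < e -> \forall i \near \oo, (f i <= e%:E)%E.
  (* The comparison factor is [expR e], whose logarithm is the required bound [e]. *)
  move=> e0; have s1 : 1 < expR e by rewrite expR_gt1.
  have d0 : 0 < (1 - (expR e)^-1) / K.
    by rewrite divr_gt0 // subr_gt0 invf_lt1 // expR_gt0.
  near=> i.
  have cmp : forall b, supp M b ->
      rho i b <= expR e * rho0 b /\ rho0 b <= expR e * rho i b.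
    apply: (unif_nbhd_comparable s1 K0) => //.
    - exact: rho_gt0.
    - by move=> b Bb; rewrite rho0_gt0 ?rho0K.
    - by near: i; exact: rho_cvg.
  rewrite /f /lipschitz_dist ge_max lee_fin (ltW e0) /=.
  apply: ge_ereal_sup => _ [[x y] /= xy <-].
  rewrite -[e in leRHS]expRK; apply: log_ratio_le.
  - exact: ltW.
  - exact: connes_dist_gt0.
  - exact: connes_dist_gt0.
  - apply: connes_dist_le_scale; rewrite ?expR_gt0 //; first exact: rho_gt0.
    by move=> b /cmp[].
  - apply: connes_dist_le_scale; rewrite ?expR_gt0 //; first exact: rho_gt0.
    by move=> b /cmp[].
have f_fin e i : (f i <= e%:E)%E -> f i \is a fin_num.
  by move=> fe; rewrite ge0_fin_numE // (le_lt_trans fe) ?ltry.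
(* Convergence in [\bar R] to a finite limit: the values are eventually finite, by the bound with
   [e = 1], and their real parts tend to 0. *)
apply/fine_cvgP; split.
  by apply: filterS (f_le 1 ltr01) => i; exact: f_fin.
apply/cvgr0Pnorm_le => e e0; apply: filterS (f_le e e0) => i fe /=.
by rewrite ger0_norm ?fine_ge0 // -lee_fin fineK // (f_fin e).
Unshelve. all: by end_near. Qed.
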